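(* Let $D$ be an integral domain that is not a field, such that its integral closure $\overline{D}$ (in its quotient field) is a Krull domain. Then $\mathrm{Princ}(D)$ is free if and only if the quotient group $\mathcal{U}(\overline{D})/\mathcal{U}(D)$ is free.
   Context: $\mathcal{U}(A)$ denotes the group of units of a ring $A$. $\mathrm{Princ}(D)$ is the group (under multiplication) of nonzero principal fractional ideals $xD$, with $x$ a nonzero element of the quotient field of $D$. ''Free'' always means free abelian. *)

(* Defs.v *)
From HB Require Import structures.
From mathcomp Require Import all_boot all_order all_algebra.
From mathcomp Require Import boolp classical_sets cardinality freeg.

Set Implicit Arguments.
Unset Strict Implicit.
Unset Printing Implicit Defensive.

Import Order.TTheory GRing.Theory Num.Theory.
Local Open Scope classical_set_scope.
Local Open Scope ring_scope.
Local Open Scope quotient_scope.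

(* [{freeg I}] is the additive group of finitely supported formal Z-linear
   combinations of elements of [I]. *)
Definition free_abelian (G : groupType) : Prop :=
  exists (I : choiceType) (f : G -> {freeg I}),
    bijective f /\ {morph f : x y / (x * y)%g >-> x + y}.

Section UnitGroup.
Variable R : unitRingType.

Record unit_group := UnitGroup {
  unit_val : R;
  unit_valP : unit_val \is a GRing.unit
}.

HB.instance Definition _ := [isSub for unit_val].
HB.instance Definition _ := [Choice of unit_group by <:].

Lemma unit_mul_subproof (u v : unit_group) :
  unit_val u * unit_val v \is a GRing.unit.
Proof. by rewrite unitrMr unit_valP. Qed.

Lemma unit_inv_subproof (u : unit_group) : (unit_val u)^-1 \is a GRing.unit.
Proof. by rewrite unitrV unit_valP. Qed.

Definition unit_one := UnitGroup (unitr1 R).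
Definition unit_mul (u v : unit_group) := UnitGroup (unit_mul_subproof u v).
Definition unit_inv (u : unit_group) := UnitGroup (unit_inv_subproof u).

Lemma unit_mulA : associative unit_mul.
Proof. by move=> u v w; apply: val_inj; rewrite /= mulrA. Qed.
Lemma unit_mul1 : left_id unit_one unit_mul.
Proof. by move=> u; apply: val_inj; rewrite /= mul1r. Qed.
Lemma unit_mulr1 : right_id unit_one unit_mul.
Proof. by move=> u; apply: val_inj; rewrite /= mulr1. Qed.
Lemma unit_mulV : left_inverse unit_one unit_inv unit_mul.
Proof. by move=> u; apply: val_inj; rewrite /= mulVr // unit_valP. Qed.
Lemma unit_mulrV : right_inverse unit_one unit_inv unit_mul.
Proof. by move=> u; apply: val_inj; rewrite /= mulrV // unit_valP. Qed.

HB.instance Definition _ := isGroup.Build unit_group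
  unit_mulA unit_mul1 unit_mulr1 unit_mulV unit_mulrV.

End UnitGroup.

Lemma unit_group_mulC (R : comUnitRingType) (u v : unit_group R) :
  (u * v = v * u)%g.
Proof. by apply: val_inj; rewrite /= mulrC. Qed.

Section UnitGroupMap.
Variables (R S : unitRingType) (f : {rmorphism R -> S}).

Lemma unit_map_subproof (u : unit_group R) :
  f (unit_val u) \is a GRing.unit.
Proof. exact/rmorph_unit/unit_valP. Qed.

Definition unit_map (u : unit_group R) : unit_group S :=
  UnitGroup (unit_map_subproof u).

Lemma unit_mapF : {morph unit_map : u v / (u / v)%g}.
Proof.
by move=> u v; apply: val_inj; rewrite /= rmorphM rmorphV // unit_valP.
Qed.

HB.instance Definition _ := isGroupMorphism.Build _ _ unit_map unit_mapF.

End UnitGroupMap.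

(* The quotient of the abelian group [G] by the image of the group morphism
   [f]; commutativity is taken as a proof, MathComp having no structure for
   multiplicative abelian groups. *)
Section QuotientGroup.
Variables (H G : groupType) (f : UMagmaMorphism.type H G).
Hypothesis mulGC : forall x y : G, (x * y = y * x)%g.

Definition quot_rel (x y : G) := `[< exists h : H, (x / y)%g = f h >].

Lemma quot_relP x y : reflect (exists h : H, x = (f h * y)%g) (quot_rel x y).
Proof.
apply: (iffP (asboolP _)) => -[h e]; exists h; first by rewrite -e divgK.
by rewrite e mulgK.
Qed.

Lemma quot_rel_refl : reflexive quot_rel.
Proof. by move=> x; apply/quot_relP; exists 1%g; rewrite gmulf1 mul1g. Qed.

Lemma quot_rel_sym : symmetric quot_rel.
Proof.
have imp x y : quot_rel x y -> quot_rel y x.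
  move=> /quot_relP[h ->]; apply/quot_relP; exists h^-1%g.
  by rewrite gmulfV mulgA mulVg mul1g.
by move=> x y; apply/idP/idP; apply: imp.
Qed.

Lemma quot_rel_trans : transitive quot_rel.
Proof.
move=> y x z /quot_relP[h ->] /quot_relP[k ->]; apply/quot_relP.
by exists (h * k)%g; rewrite gmulfM mulgA.
Qed.

Canonical quot_equiv :=
  EquivRel quot_rel quot_rel_refl quot_rel_sym quot_rel_trans.
Canonical quot_equiv_direct := defaultEncModRel quot_rel.

Definition quotient_group
  of (forall x y : G, (x * y = y * x)%g) := {eq_quot quot_rel}.
Local Notation Q := (quotient_group mulGC).

HB.instance Definition _ : EqQuotient G quot_rel Q := EqQuotient.on Q.
HB.instance Definition _ := Choice.on Q.

Definition quot_one := lift_cst Q 1%g.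
Definition quot_mul := lift_op2 Q (fun x y : G => (x * y)%g).
Definition quot_inv := lift_op1 Q (fun x : G => x^-1%g).

Lemma pi_quot_one : \pi_Q 1%g = quot_one.
Proof. by rewrite /quot_one -lock. Qed.

Lemma pi_quot_mul : {morph \pi_Q : x y / (x * y)%g >-> quot_mul x y}.
Proof.
move=> x y; unlock quot_mul; apply/eqmodP/quot_relP => /=.
have /eqmodP/quot_relP[h hE] := esym (reprK (\pi_Q x)).
have /eqmodP/quot_relP[k kE] := esym (reprK (\pi_Q y)).
exists (h * k)%g; rewrite gmulfM {1}hE {1}kE -!mulgA; congr (_ * _)%g.
by rewrite !mulgA [X in (X * _)%g]mulGC.
Qed.

Lemma pi_quot_inv : {morph \pi_Q : x / x^-1%g >-> quot_inv x}.
Proof.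
move=> x; unlock quot_inv; apply/eqmodP/quot_relP => /=.
have /eqmodP/quot_relP[h hE] := esym (reprK (\pi_Q x)).
by exists h^-1%g; rewrite gmulfV {1}hE invgM mulGC.
Qed.

Lemma quot_mulA : associative quot_mul.
Proof.
move=> x y z; rewrite -[x]reprK -[y]reprK -[z]reprK.
by rewrite -!pi_quot_mul mulgA.
Qed.
Lemma quot_mul1 : left_id quot_one quot_mul.
Proof.
by move=> x; rewrite -[x]reprK -pi_quot_one -pi_quot_mul mul1g.
Qed.
Lemma quot_mulr1 : right_id quot_one quot_mul.
Proof.
by move=> x; rewrite -[x]reprK -pi_quot_one -pi_quot_mul mulg1.
Qed.
Lemma quot_mulV : left_inverse quot_one quot_inv quot_mul.
Proof.
move=> x; rewrite -[x]reprK -pi_quot_inv -pi_quot_mul mulVg.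
exact: pi_quot_one.
Qed.
Lemma quot_mulrV : right_inverse quot_one quot_inv quot_mul.
Proof.
move=> x; rewrite -[x]reprK -pi_quot_inv -pi_quot_mul mulgV.
exact: pi_quot_one.
Qed.

HB.instance Definition _ := isGroup.Build Q
  quot_mulA quot_mul1 quot_mulr1 quot_mulV quot_mulrV.

End QuotientGroup.

Section IntegralClosure.
Variable D : idomainType.

Definition integral_pred : {pred {fraction D}} :=
  fun x => `[< integralOver (@tofrac D) x >].

Lemma integral_predP x :
  reflect (integralOver (@tofrac D) x) (x \in integral_pred).
Proof. exact: asboolP. Qed.

Lemma integral_pred_subring : subring_closed integral_pred.
Proof.
split=> [|x y /integral_predP hx /integral_predP hy
         |x y /integral_predP hx /integral_predP hy]; apply/integral_predP.
- exact: integral1.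
- exact: integral_sub.
- exact: integral_mul.
Qed.

HB.instance Definition _ := GRing.isSubringClosed.Build _ integral_pred
  integral_pred_subring.

Record integral_closure := IntegralClosure {
  icl_val : {fraction D};
  icl_valP : icl_val \in integral_pred
}.

HB.instance Definition _ := [isSub for icl_val].
HB.instance Definition _ := [Choice of integral_closure by <:].
HB.instance Definition _ := [SubChoice_isSubComNzRing of integral_closure by <:].

(* [icl_mulV] and [icl_unitPl] show that these are exactly the invertible
   elements of the ring. *)
Definition icl_unit : {pred integral_closure} :=
  fun x => (icl_val x != 0) && ((icl_val x)^-1 \in integral_pred).
Definition icl_inv (x : integral_closure) : integral_closure :=
  if icl_unit x then insubd x (icl_val x)^-1 else x.

Lemma icl_mulV : {in icl_unit, left_inverse 1 icl_inv *%R}.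
Proof.
move=> x xU; have /andP[x0 xV] : icl_unit x := xU.
apply: val_inj; rewrite /icl_inv; have -> : icl_unit x := xU.
by rewrite rmorphM /= insubdK // mulVf.
Qed.

Lemma icl_unitPl (x y : integral_closure) : y * x = 1 -> icl_unit x.
Proof.
move=> /(congr1 icl_val) /= e.
have x0 : icl_val x != 0.
  apply: contra_eq_neq e => ->; rewrite mulr0 eq_sym; exact: oner_neq0.
rewrite /icl_unit x0 /=.
suff -> : (icl_val x)^-1 = icl_val y by exact: icl_valP.
by apply: (mulIf x0); rewrite mulVf.
Qed.

Lemma icl_inv_out : {in [predC icl_unit], icl_inv =1 id}.
Proof.
by move=> x xU; rewrite /icl_inv; have /negbTE -> : ~~ icl_unit x := xU.
Qed.

HB.instance Definition _ := GRing.ComNzRing_hasMulInverse.Build integral_closure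
  icl_mulV icl_unitPl icl_inv_out.

Lemma icl_integral (x y : integral_closure) :
  x * y = 0 -> (x == 0) || (y == 0).
Proof.
move=> /(congr1 icl_val)/eqP; rewrite /= mulf_eq0.
by rewrite -!(inj_eq val_inj).
Qed.

HB.instance Definition _ := GRing.ComUnitRing_isIntegral.Build integral_closure
  icl_integral.

Lemma to_icl_subproof (d : D) : tofrac d \in integral_pred.
Proof. exact/integral_predP/integral_id. Qed.

Definition to_icl (d : D) : integral_closure :=
  IntegralClosure (to_icl_subproof d).

Lemma to_icl_zmod : zmod_morphism to_icl.
Proof. by move=> x y; apply: val_inj; rewrite /= rmorphB. Qed.
Lemma to_icl_monoid : monoid_morphism to_icl.
Proof.
by split=> [|x y]; apply: val_inj; rewrite /= ?rmorph1 ?rmorphM.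
Qed.
HB.instance Definition _ :=
  GRing.isZmodMorphism.Build D integral_closure to_icl to_icl_zmod.
HB.instance Definition _ :=
  GRing.isMonoidMorphism.Build D integral_closure to_icl to_icl_monoid.

(* U(D) embeds in the unit group of the integral closure via [unit_map to_icl];
   the quotient is by the image of this embedding. *)
Definition units_quotient : groupType :=
  quotient_group (unit_map to_icl) (@unit_group_mulC integral_closure).

End IntegralClosure.

(* Normalized rank one discrete valuations, restricted to nonzero elements:
   the value at 0, conventionally +oo, is left unconstrained. *)
Definition discrete_valuation (K : fieldType) (v : K -> int) : Prop :=
  [/\ forall x y, x != 0 -> y != 0 -> v (x * y) = v x + v y,
      forall x y, x != 0 -> y != 0 -> x + y != 0 ->
        Num.min (v x) (v y) <= v (x + y)
    & forall n : int, exists2 x, x != 0 & v x = n].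

(* A is an intersection of discrete valuation rings of its quotient field, of
   finite character. *)
Definition krull_domain (A : idomainType) : Prop :=
  exists V : set ({fraction A} -> int),
    [/\ forall v, V v -> discrete_valuation v,
        forall x, x != 0 ->
          ((exists a : A, x = tofrac a) <-> forall v, V v -> 0 <= v x)
      & forall x, x != 0 -> finite_set [set v | V v /\ v x != 0]].

Section Princ.
Variable D : idomainType.
Local Notation K := {fraction D}.

Definition principal_ideal (x : K) : set K :=
  [set z | exists d : D, z = x * tofrac d].

(* Finite sums of products. *)
Definition ideal_mul (I J : set K) : set K :=
  [set z | exists s : seq (K * K),
     (forall p, p \in s -> I p.1 /\ J p.2) /\ z = \sum_(p <- s) p.1 * p.2].

(* The colon ideal (D :_K I). *)
Definition ideal_inv (I : set K) : set K :=
  [set z | forall x, I x -> exists d : D, z * x = tofrac d].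

Lemma principal_ideal_mul x y :
  ideal_mul (principal_ideal x) (principal_ideal y) =
  principal_ideal (x * y).
Proof.
apply/seteqP; split=> z /=.
  case=> s [sP ->]; elim: s sP => [|p s IHs] sP.
    by exists 0; rewrite big_nil rmorph0 mulr0.
  have [|d dE] := IHs; first by move=> q qs; apply: sP; rewrite inE qs orbT.
  have [[a aE] [b bE]] := sP p (mem_head _ _).
  exists (a * b + d); rewrite big_cons dE aE bE rmorphD rmorphM mulrDr.
  by rewrite mulrACA.
case=> d ->; exists [:: (x * tofrac d, y)]; split.
  move=> p; rewrite inE => /eqP -> /=; split; first by exists d.
  by exists 1; rewrite rmorph1 mulr1.
by rewrite big_seq1 /= mulrAC.
Qed.

Lemma principal_ideal_inv x : x != 0 ->
  ideal_inv (principal_ideal x) = principal_ideal x^-1.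
Proof.
move=> x0; apply/seteqP; split=> z /=.
  move=> /(_ x) [|d dE]; first by exists 1; rewrite rmorph1 mulr1.
  by exists d; rewrite -dE mulrCA mulVf ?mulr1.
case=> d -> _ [e ->]; exists (d * e).
by rewrite mulrACA mulVf // mul1r rmorphM.
Qed.

Record Princ := MkPrinc {
  princ_val : set K;
  princ_valP : `[< exists2 x, x != 0 & princ_val = principal_ideal x >]
}.

HB.instance Definition _ := [isSub for princ_val].
HB.instance Definition _ := [Choice of Princ by <:].

Lemma princP (I : Princ) :
  exists2 x, x != 0 & princ_val I = principal_ideal x.
Proof. exact/asboolP/princ_valP. Qed.

Lemma princ_one_subproof :
  `[< exists2 x, x != 0 & principal_ideal 1 = principal_ideal x >].
Proof. by apply/asboolP; exists 1 => //; apply: oner_neq0. Qed.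

Lemma princ_mul_subproof (I J : Princ) :
  `[< exists2 x, x != 0 &
      ideal_mul (princ_val I) (princ_val J) = principal_ideal x >].
Proof.
apply/asboolP; have [[x x0 ->] [y y0 ->]] := (princP I, princP J).
by exists (x * y); rewrite ?mulf_neq0 ?principal_ideal_mul.
Qed.

Lemma princ_inv_subproof (I : Princ) :
  `[< exists2 x, x != 0 & ideal_inv (princ_val I) = principal_ideal x >].
Proof.
apply/asboolP; have [x x0 ->] := princP I.
by exists x^-1; rewrite ?invr_eq0 ?principal_ideal_inv.
Qed.

Definition princ_one := MkPrinc princ_one_subproof.
Definition princ_mul (I J : Princ) := MkPrinc (princ_mul_subproof I J).
Definition princ_inv (I : Princ) := MkPrinc (princ_inv_subproof I).

Lemma princ_mulA : associative princ_mul.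
Proof.
move=> I J L; apply: val_inj => /=.
have [[[x _ ->] [y _ ->]] [z _ ->]] := (princP I, princP J, princP L).
by rewrite !principal_ideal_mul mulrA.
Qed.
Lemma princ_mul1 : left_id princ_one princ_mul.
Proof.
move=> I; apply: val_inj => /=; have [x _ ->] := princP I.
by rewrite principal_ideal_mul mul1r.
Qed.
Lemma princ_mulr1 : right_id princ_one princ_mul.
Proof.
move=> I; apply: val_inj => /=; have [x _ ->] := princP I.
by rewrite principal_ideal_mul mulr1.
Qed.
Lemma princ_mulV : left_inverse princ_one princ_inv princ_mul.
Proof.
move=> I; apply: val_inj => /=; have [x x0 ->] := princP I.
by rewrite principal_ideal_inv // principal_ideal_mul mulVf.
Qed.
Lemma princ_mulrV : right_inverse princ_one princ_inv princ_mul.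
Proof.
move=> I; apply: val_inj => /=; have [x x0 ->] := princP I.
by rewrite principal_ideal_inv // principal_ideal_mul mulfV.
Qed.

HB.instance Definition _ := isGroup.Build Princ
  princ_mulA princ_mul1 princ_mulr1 princ_mulV princ_mulrV.

End Princ.

(* Main.v *)
(* Normalized valuations give a homomorphism from Princ(D) to the free abelian
   group on the valuations of the Krull domain, whose kernel is the image of the
   embedding of the quotient of the unit groups, [u |-> u D].  The image of
   this homomorphism is free, being a subgroup of a free abelian group, so
   Princ(D) is the direct sum of the quotient of the unit groups and a free
   group; one implication follows from this splitting, the other because the
   quotient of the unit groups is itself a subgroup of Princ(D). *)
Require Import Defs.
From HB Require Import structures.
From mathcomp Require Import all_boot all_order all_algebra.
From mathcomp Require Import boolp classical_sets cardinality freeg wochoice.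

Set Implicit Arguments.
Unset Strict Implicit.
Unset Printing Implicit Defensive.

Import Order.TTheory GRing.Theory Num.Theory.
Local Open Scope ring_scope.

(** * Well-orders: transitivity, finite maxima and induction *)

Section WellOrder.
Variables (T : eqType) (R : rel T).
Hypothesis woR : well_order R.

Let chR : wo_chain R predT. Proof. exact: withinW. Qed.

Lemma well_order_refl : reflexive R.
Proof. by move=> x; apply: (wo_chain_reflexive chR). Qed.

Lemma well_order_anti : antisymmetric R.
Proof. by move=> x y; apply: (wo_chain_antisymmetric chR). Qed.

Lemma well_order_total : total R.
Proof. by move=> x y; apply: (wo_chainW chR). Qed.

(** The least element of [{x, y, z}] decides: if it is [y] or [z], antisymmetry makes two of the
    three points equal. *)
Lemma well_order_trans : transitive R.
Proof.
move=> y x z Rxy Ryz.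
have [|w [[]]] := woR (A := mem [:: x; y; z]).
  by exists x; exact: mem_head.
rewrite !inE => /or3P[]/eqP-> lb _; first by apply: lb; rewrite !inE eqxx !orbT.
  have Ryx := lb x (mem_head _ _).
  by rewrite (@well_order_anti x y) // Rxy Ryx.
have Rzy : R z y by apply: lb; rewrite !inE eqxx !orbT.
by rewrite -(@well_order_anti y z) // Ryz Rzy.
Qed.

Lemma well_order_seq_max (s : seq T) :
  s != [::] -> exists2 x, x \in s & {in s, forall y, R y x}.
Proof.
elim: s => // x [|z s] IHs _.
  by exists x; rewrite ?mem_head // => y /[!inE] /eqP->; exact: well_order_refl.
have [//|m ms mM] := IHs.
case/orP: (well_order_total x m) => [Rxm|Rmx].
  exists m => [|y]; first by rewrite in_cons ms orbT.
  by rewrite in_cons => /predU1P[->//|/mM].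
exists x => [|y]; first exact: mem_head.
rewrite in_cons => /predU1P[->|/mM Rym].
  exact: well_order_refl.
exact: well_order_trans Rym Rmx.
Qed.

(** By the least counterexample. *)
Lemma well_order_ind (P : T -> Prop) :
  (forall x, (forall y, R y x -> y != x -> P y) -> P x) -> forall x, P x.
Proof.
move=> IH; suff nP : ~ nonempty [pred x | `[< ~ P x >]].
  by move=> x; apply: contrapT => Px; apply: nP; exists x; apply/asboolP.
move=> /woR[x [[/asboolP Px lb] _]]; apply/Px/IH => y Ryx yx.
apply: contrapT => /asboolP/lb Rxy; move/eqP: yx; apply.
by apply: well_order_anti; rewrite Ryx.
Qed.

End WellOrder.

(** * The universal property of free abelian groups *)

Section FreegLift.
Variables (I : choiceType).
Implicit Types (M : zmodType).

(** [fglift] has values in a module, so [M] is viewed as a module over the integers. *)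
Definition freeg_lift M (f : I -> M) (x : {freeg I}) : M :=
  fglift (f : I -> ssrint.zmodule M) x.

Lemma freeg_lift_zmod M (f : I -> M) : zmod_morphism (freeg_lift f).
Proof. exact: (@lift_is_additive int I (ssrint.zmodule M) f). Qed.

HB.instance Definition _ M (f : I -> M) :=
  GRing.isZmodMorphism.Build {freeg I} M (freeg_lift f) (freeg_lift_zmod f).

Lemma freeg_liftU M (f : I -> M) i : freeg_lift f << i >> = f i.
Proof. by rewrite /freeg_lift liftU scale1r. Qed.

Lemma freegUE (k : int) (i : I) : << k *g i >> = << i >> *~ k :> {freeg I}.
Proof. by rewrite freeg_mulz intz. Qed.

Lemma freeg_eq_add M (f g : {additive {freeg I} -> M}) :
  (forall i, f << i >> = g << i >>) -> f =1 g.
Proof.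
move=> fg x; rewrite -(freeg_sumE x) !raddf_sum; apply: eq_bigr => i _.
by rewrite freegUE !raddfMz fg.
Qed.

Lemma freeg_add_sum M (f : {additive {freeg I} -> M}) (x : {freeg I}) :
  f x = \sum_(i <- dom x) f << i >> *~ coeff i x.
Proof.
rewrite -{1}(freeg_sumE x) raddf_sum; apply: eq_bigr => i _.
by rewrite freegUE raddfMz.
Qed.

End FreegLift.

(** * Images in free abelian groups are free *)

Section FreegImage.
Variables (M : zmodType) (I : choiceType) (q : {additive M -> {freeg I}}).
Variable R : rel I.
Hypothesis woR : well_order R.

Let below i m := {in dom (q m), forall j, R j i}.

(** Vanishing of coefficients is visibly a linear condition, which gives closure under the operation
    in [below_sub]. *)
Let belowE i m : below i m <-> forall j, ~~ R j i -> coeff j (q m) = 0.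
Proof.
split=> [bm j|bm j]; last by rewrite mem_dom; apply: contraNT => /bm->.
by move=> nR; apply/coeff_outdom/(contra _ nR)/bm.
Qed.

Let below_sub i m n k : below i m -> below i n -> below i (m - n *~ k).
Proof.
move=> /belowE bm /belowE bn; apply/belowE => j jR.
by rewrite raddfB raddfMz coeffB raddfMz /= bm ?bn // mul0rz subr0.
Qed.

(* The [i]-coefficients of the elements with support bounded by [i] form a
   subgroup of Z, hence a principal one. *)
Lemma freeg_lead_gen i : exists h, below i h /\
  forall m, below i m -> exists k, coeff i (q m) = coeff i (q h) * k.
Proof.
(* The shift by one restricts the search for a least absolute value to nonzero coefficients. *)
pose P n := `[< exists2 h, below i h & n.+1%N = `|coeff i (q h)|%N >].
have [exP|nexP] := pselect (exists n, P n); last first.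
  exists 0; split=> [j|m bm]; first by rewrite raddf0 dom0.
  exists 0; rewrite mulr0; apply: contrapT => /eqP nz; apply: nexP.
  exists `|coeff i (q m)|.-1%N; apply/asboolP; exists m => //.
  by rewrite prednK ?absz_gt0.
case: (ex_minnP exP) => n /asboolP[h bh hn] nmin; exists h; split=> // m bm.
set d := coeff i (q h); set x := coeff i (q m).
have d0 : d != 0 by rewrite -absz_gt0 -hn.
(* Euclidean division: a nonzero remainder would be the [i]-coefficient of [m - h *~ (x %/ d)],
   smaller in absolute value than the minimal [d]. *)
exists (x %/ d)%Z; rewrite mulrC {1}(divz_eq x d) -[RHS]addr0; congr (_ + _).
apply: contrapT => /eqP r0.
have rE : (x %% d)%Z = coeff i (q (m - h *~ (x %/ d)%Z)).
  by rewrite raddfB raddfMz coeffB raddfMz /= -/d -/x mulrzz [d * _]mulrC.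
suff : (`|(x %% d)%Z|.-1 < n)%N.
  rewrite ltnNge => /negP; apply; apply: nmin; apply/asboolP.
  exists (m - h *~ (x %/ d)%Z); first exact: below_sub.
  by rewrite -rE prednK ?absz_gt0.
rewrite -ltnS prednK ?absz_gt0// hn -ltz_nat !abszE ger0_norm ?modz_ge0//.
exact: ltz_mod.
Qed.

(* The elements [h i] of [freeg_lead_gen] with nonzero leading coefficient map to
   a basis of the image of [q]: leading terms give independence, and well-founded
   induction on the largest index of the support gives generation. *)
Lemma freeg_image_free_wo : exists (J : choiceType)
    (b : {additive {freeg J} -> M}),
  (forall x, q (b x) = 0 -> x = 0) /\ forall m, exists x, q m = q (b x).
Proof.
have [h hP] := choice freeg_lead_gen.
have bh i : below i (h i) by have [] := hP i.
pose J : choiceType := {i | coeff i (q (h i)) != 0}.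
pose b : {additive {freeg J} -> M} := freeg_lift (fun j : J => h (val j)).
have bU (j : J) : b << j >> = h (val j) by exact: freeg_liftU.
exists J, b; split=> [x|].
  move=> qx0; have [//|] := eqVneq x 0; rewrite -dom_eq0 => nx; exfalso.
  pose RJ := relpre (val : J -> I) R.
  have [j jx jM] : exists2 j, j \in dom x & {in dom x, forall k, RJ k j}.
    have [|i /mapP[j jx ->] ile] :=
      well_order_seq_max woR (s := map val (dom x)).
      by case: (dom x) nx.
    by exists j => // k kx; apply/ile/map_f.
  (* At the largest index [j] only the [j]-term contributes: for the other [k] in the support,
     [q (h k)] is supported below [k], which precedes [j]. *)
  have := congr1 (coeff (val j)) qx0.
  rewrite coeff0 freeg_add_sum !raddf_sum /= (bigD1_seq j) ?uniq_dom //=.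
  rewrite big1_seq ?addr0.
    rewrite bU !raddfMz /= mulrzz => /eqP.
    by apply/negP; rewrite mulf_neq0 ?(valP j) -?mem_dom.
  move=> k /andP[kj kx]; rewrite bU !raddfMz /=.
  rewrite coeff_outdom ?mul0rz //; apply: contra kj => jk.
  apply/eqP/val_inj/(well_order_anti woR); rewrite (bh (val k) _ jk) andbT.
  exact: jM.
suff IH i m : below i m -> exists x, q m = q (b x).
  move=> m; have [qm0|qm0] := eqVneq (q m) 0.
    by exists 0; rewrite [b 0]raddf0 [q 0]raddf0.
  have [|i _ /IH//] := well_order_seq_max woR (s := dom (q m)).
  by rewrite dom_eq0.
elim/(well_order_ind woR): i m => i IH m bm.
(* Taking [k = 0] when the leading coefficient vanishes avoids using [h i] for an [i] outside
   [J]. *)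
have [k [kE k0]] : exists k, coeff i (q m) = coeff i (q (h i)) * k /\
    (coeff i (q (h i)) == 0 -> k = 0).
  have [k kE] := (hP i).2 m bm; case: eqVneq => [hi0|_]; last by exists k.
  by exists 0; rewrite kE hi0 !mul0r.
(* The [i]-coefficient is cancelled, so the largest index of the support drops strictly below
   [i]. *)
pose m' := m - h i *~ k.
have [x xE] : exists x, q m' = q (b x).
  have [qm0|qm0] := eqVneq (q m') 0.
    by exists 0; rewrite [b 0]raddf0 [q 0]raddf0.
  have [|j jm jM] := well_order_seq_max woR (s := dom (q m')).
    by rewrite dom_eq0.
  apply: (IH j) => //; first exact: (below_sub bm (bh i) jm).
  apply: contraTneq jm => ->; rewrite mem_dom negbK.
  by rewrite raddfB raddfMz coeffB raddfMz /= kE -mulrzz subrr.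
have qmE : q m = q (b x) + q (h i) *~ k.
  by rewrite -xE -raddfMz -raddfD subrK.
case: (boolP (coeff i (q (h i)) == 0)) => [/k0 kz|hi0].
  by exists x; rewrite qmE kz mulr0z addr0.
exists (x + << (Sub i hi0 : J) >> *~ k); rewrite qmE !raddfD !raddfMz /=.
by rewrite bU.
Qed.
End FreegImage.

(** The composite of [q] and [b] is an isomorphism onto the image of [q]; thus [b] splits [q] over
    its image. *)
Lemma freeg_image_free (M : zmodType) (I : choiceType)
    (q : {additive M -> {freeg I}}) :
  exists (J : choiceType) (b : {additive {freeg J} -> M}),
    (forall x, q (b x) = 0 -> x = 0) /\ forall m, exists x, q m = q (b x).
Proof.
by have [R woR] := well_ordering_principle I; apply: freeg_image_free_wo woR.
Qed.

(** * Direct sums and extensions of free groups *)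

Definition free_zmod (M : zmodType) : Prop :=
  exists (I : choiceType) (b : {additive {freeg I} -> M}), bijective b.

Lemma inj_surj_bij (T U : Type) (f : T -> U) :
  injective f -> (forall y, exists x, f x = y) -> bijective f.
Proof.
by move=> fI /choice[g fgK]; exists g => // x; apply: fI.
Qed.

(** The hypotheses present [M] as an internal direct sum; the disjoint union of the two bases is a
    basis. *)
Lemma free_zmod_sum (M : zmodType) (I J : choiceType)
    (b : {additive {freeg I} -> M}) (c : {additive {freeg J} -> M}) :
  (forall x y, b x + c y = 0 -> x = 0 /\ y = 0) ->
  (forall m, exists x y, m = b x + c y) -> free_zmod M.
Proof.
move=> bc0 bcM.
pose d : {additive {freeg (I + J)%type} -> M} := freeg_lift
  (fun s : I + J => match s with inl i => b << i >> | inr j => c << j >> end).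
(* The projections [p1], [p2] and inclusions [e1], [e2] identify the free group on [I + J] with the
   sum of the two free groups. *)
pose p1 : {additive {freeg (I + J)%type} -> {freeg I}} := freeg_lift
  (fun s : I + J => if s is inl i then << i >> else 0 : {freeg I}).
pose p2 : {additive {freeg (I + J)%type} -> {freeg J}} := freeg_lift
  (fun s : I + J => if s is inr j then << j >> else 0 : {freeg J}).
pose e1 : {additive {freeg I} -> {freeg (I + J)%type}} :=
  freeg_lift (fun i => << inl i >> : {freeg (I + J)%type}).
pose e2 : {additive {freeg J} -> {freeg (I + J)%type}} :=
  freeg_lift (fun j => << inr j >> : {freeg (I + J)%type}).
have dE : d =1 (b \o p1) \+ (c \o p2).
  apply: freeg_eq_add => -[i|j].
    by rewrite /= !freeg_liftU raddf0 addr0.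
  by rewrite /= !freeg_liftU raddf0 add0r.
have idE : idfun =1 (e1 \o p1) \+ (e2 \o p2).
  apply: freeg_eq_add => -[i|j].
    by rewrite /= !freeg_liftU raddf0 addr0.
  by rewrite /= !freeg_liftU raddf0 add0r.
have de1 : d \o e1 =1 b by apply: freeg_eq_add => i; rewrite /= !freeg_liftU.
have de2 : d \o e2 =1 c by apply: freeg_eq_add => i; rewrite /= !freeg_liftU.
exists (I + J)%type, d; apply: inj_surj_bij.
  apply: raddf_inj => x; rewrite dE => /bc0[p10 p20].
  by rewrite -[x]/(idfun x) idE /= p10 p20 !raddf0 addr0.
move=> m; have [x [y ->]] := bcM m; exists (e1 x + e2 y).
by rewrite raddfD -[d (e1 x)]/((d \o e1) x) -[d (e2 y)]/((d \o e2) y) de1 de2.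
Qed.

Lemma free_zmod_extension (N M : zmodType) (I : choiceType)
    (i : {additive N -> M}) (q : {additive M -> {freeg I}}) :
  injective i -> (forall m, q m = 0 <-> exists n, m = i n) ->
  free_zmod M <-> free_zmod N.
Proof.
move=> iI qi; have qi0 n : q (i n) = 0 by apply/qi; exists n.
split=> [[J [f [g fK gK]]]|[J [f fB]]].
  have gB : zmod_morphism g.
    by move=> x y; apply: (can_inj fK); rewrite raddfB !gK.
  pose gA := GRing.isZmodMorphism.Build _ _ g gB.
  pose ga : {additive M -> {freeg J}} := HB.pack g gA.
  (* [ga \o i] embeds [N] in a free group, and injectivity carries the basis of its image back to
     [N]. *)
  have [K [b [bI bS]]] := freeg_image_free (ga \o i).
  exists K, b; apply: inj_surj_bij => [|n].
    by apply: raddf_inj => x bx0; apply: bI; rewrite bx0 raddf0.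
  by have [x] := bS n; move=> /(can_inj gK)/iI ->; exists x.
(* The splitting [b] makes [M] the direct sum of the image of [i], which is the kernel of [q], and
   the image of [b]. *)
have [K [b [bI bS]]] := freeg_image_free q.
apply: (free_zmod_sum (b := i \o f) (c := b)) => [x y|m].
  move=> e; have y0 : y = 0.
    by apply: bI; move: (congr1 q e); rewrite raddfD /= qi0 add0r raddf0.
  move: e; rewrite y0 raddf0 addr0 /= -[RHS](raddf0 i) => /iI.
  by rewrite -[RHS](raddf0 f) => /(bij_inj fB).
have [x xE] := bS m; have [|n nE] := (qi (m - b x)).1.
  by rewrite raddfB xE subrr.
have [g _ gK] := fB; exists (g n), x.
by rewrite /= gK -nE subrK.
Qed.

(** * From multiplicative groups to additive ones *)

Section Additive.
Variable G : groupType.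
Hypothesis mulGC : forall x y : G, (x * y = y * x)%g.

(** The commutativity proof is an argument of the alias so that the [zmodType] instance, which
    requires it, can be attached to the type. *)
Definition additive_group of (forall x y : G, (x * y = y * x)%g) : Type := G.
Local Notation A := (additive_group mulGC).

HB.instance Definition _ := Choice.on A.
HB.instance Definition _ := GRing.isZmodule.Build A
  (@mulgA G) mulGC (@mul1g G) (@mulVg G).

(** The two notions orient the isomorphism oppositely; the inverse of an additive bijection is
    additive. *)
Lemma free_abelianP : free_abelian G <-> free_zmod A.
Proof.
split=> [[I [f [[g fK gK] fM]]]|[I [b [g bK gK]]]].
  have fV u v : f (u / v)%g = f u - f v.
    by apply: (addIr (f v)); rewrite -fM divgK subrK.
  have gB : zmod_morphism (g : {freeg I} -> A).
    by move=> x y; apply: (can_inj fK); rewrite gK [RHS]fV !gK.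
  pose gA := GRing.isZmodMorphism.Build _ _ _ gB.
  pose ga : {additive {freeg I} -> A} := HB.pack g gA.
  by exists I, ga; exists f.
exists I, g; split; first by exists b.
by move=> x y; apply: (can_inj bK); rewrite raddfD !gK.
Qed.

End Additive.

Lemma free_abelian_extension (N M : groupType) (I : choiceType)
    (i : N -> M) (q : M -> {freeg I}) :
  (forall x y : N, (x * y = y * x)%g) -> (forall x y : M, (x * y = y * x)%g) ->
  {morph i : x y / (x * y)%g} -> {morph q : x y / (x * y)%g >-> x + y} ->
  injective i -> (forall m, q m = 0 <-> exists n, m = i n) ->
  free_abelian M <-> free_abelian N.
Proof.
move=> NC MC iM qM iI qi; rewrite (free_abelianP NC) (free_abelianP MC).
have iB : zmod_morphism (i : additive_group NC -> additive_group MC).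
  move=> x y; have iV u v : i (u / v)%g = (i u / i v)%g.
    by apply: (mulIg (i v)); rewrite -iM !divgK.
  exact: iV.
have qB : zmod_morphism (q : additive_group MC -> {freeg I}).
  move=> x y; have qV u v : q (u / v)%g = q u - q v.
    by apply: (addIr (q v)); rewrite -qM divgK subrK.
  exact: qV.
pose iA := GRing.isZmodMorphism.Build _ _ _ iB.
pose qA := GRing.isZmodMorphism.Build _ _ _ qB.
pose ia : {additive additive_group NC -> additive_group MC} := HB.pack i iA.
pose qa : {additive additive_group MC -> {freeg I}} := HB.pack q qA.
exact: (free_zmod_extension (i := ia) (q := qa)).
Qed.

Local Open Scope quotient_scope.

Lemma quotient_groupC (H G : groupType) (f : UMagmaMorphism.type H G)
    (mulGC : (forall x y : G, (x * y = y * x)%g)) :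
  forall x y : quotient_group f mulGC, (x * y = y * x)%g.
Proof.
move=> x y; rewrite -[x]reprK -[y]reprK.
by rewrite -[LHS]pi_quot_mul mulGC [LHS]pi_quot_mul.
Qed.

(** * Identifying the quotient fields of [D] and of its integral closure *)

Section Fractions.
Variable D : idomainType.
Local Notation K := {fraction D}.
Local Notation A := (integral_closure D).
Local Notation L := {fraction A}.

Lemma frac_reprE (x : K) :
  x * tofrac (\d_(repr x)) = tofrac (\n_(repr x)).
Proof.
rewrite -{1}[x]reprK; unlock tofrac; rewrite -[LHS]FracField.pi_mul.
rewrite /FracField.mulf !numden_Ratio ?oner_neq0 // mulr1.
apply/eqmodP; rewrite /= FracField.equivfE.
rewrite !numden_Ratio ?oner_neq0 ?denom_ratioP //.
by rewrite mulr1 mulrC.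
Qed.

(* The fraction fields of [D] and of its integral closure are the same field, but
   they are distinct types; this is the identification between them. *)
Definition frac_icl (x : K) : L :=
  tofrac (to_icl (\n_(repr x))) / tofrac (to_icl (\d_(repr x))).

Lemma to_icl_eq0 (d : D) : (to_icl d == 0) = (d == 0).
Proof. by rewrite -(inj_eq val_inj) /= tofrac_eq0. Qed.

(** Independence of the chosen representative, in a form free of division: both sides are
    cross-multiplied and compared in [A], where [icl_val] is injective. *)
Lemma frac_iclP (x : K) (a b : A) :
  x * icl_val b = icl_val a -> frac_icl x * tofrac b = tofrac a.
Proof.
move=> xE; rewrite /frac_icl mulrAC; apply/eqP.
have d0 : tofrac (to_icl \d_(repr x)) != 0.
  by rewrite tofrac_eq0 to_icl_eq0 denom_ratioP.
rewrite (can2_eq (divfK d0) (mulfK d0)) -!rmorphM tofrac_eq.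
by rewrite -(inj_eq val_inj) /= -xE -frac_reprE mulrAC.
Qed.

Lemma frac_icl_val (a : A) : frac_icl (icl_val a) = tofrac a.
Proof. by rewrite -[LHS]mulr1 -tofrac1; apply: frac_iclP; rewrite /= mulr1. Qed.

Lemma frac_iclM : {morph frac_icl : x y / x * y}.
Proof.
move=> x y.
set b := to_icl \d_(repr x); set c := to_icl \d_(repr y).
have b0 : tofrac b != 0.
  by rewrite tofrac_eq0 to_icl_eq0 denom_ratioP.
have c0 : tofrac c != 0.
  by rewrite tofrac_eq0 to_icl_eq0 denom_ratioP.
apply: (mulIf (mulf_neq0 b0 c0)); rewrite [RHS]mulrACA -tofracM.
have xE : x * icl_val b = icl_val (to_icl \n_(repr x)) by exact: frac_reprE.
have yE : y * icl_val c = icl_val (to_icl \n_(repr y)) by exact: frac_reprE.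
rewrite (frac_iclP xE) (frac_iclP yE) -tofracM; apply: frac_iclP.
by rewrite -[icl_val (b * c)]/(icl_val b * icl_val c) mulrACA xE yE.
Qed.

Lemma frac_icl_eq0 (x : K) : (frac_icl x == 0) = (x == 0).
Proof.
rewrite /frac_icl mulf_eq0 invr_eq0 !tofrac_eq0 !to_icl_eq0.
rewrite (negbTE (denom_ratioP _)) orbF.
rewrite -tofrac_eq0 -frac_reprE mulf_eq0 tofrac_eq0.
by rewrite (negbTE (denom_ratioP _)) orbF.
Qed.

(** This brings membership in the integral closure, tested by valuations on [L], back to [K]. *)
Lemma frac_icl_tofrac (x : K) (a : A) : frac_icl x = tofrac a -> x = icl_val a.
Proof.
rewrite /frac_icl => /eqP; set n := \n_(repr x); set d := \d_(repr x).
have d0 : d != 0 := denom_ratioP _.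
have ad0 : tofrac (to_icl d) != 0 by rewrite tofrac_eq0 to_icl_eq0.
rewrite (can2_eq (divfK ad0) (mulfK ad0)) -rmorphM tofrac_eq.
rewrite -(inj_eq val_inj) /= -frac_reprE => /eqP xE.
have kd0 : tofrac d != 0 by rewrite tofrac_eq0.
exact: (mulIf kd0).
Qed.

End Fractions.

Lemma freeg_of_finite_support (T : choiceType) (f : T -> int) :
  finite_set [set t | f t != 0] ->
  exists x : {freeg T}, forall t, coeff t x = f t.
Proof.
move=> /finite_seqP[s sE]; exists (\sum_(t <- undup s) << f t *g t >>) => t.
have e : (f t != 0 : Prop) = (t \in s) := congr1 (@^~ t) sE.
have {e} ts : (t \in s) = (f t != 0) by apply/idP/idP; rewrite e.
rewrite raddf_sum /=.
have [fs|fs] := boolP (t \in s).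
  rewrite (bigD1_seq t) ?mem_undup ?undup_uniq //= coeffU eqxx mulr1.
  by rewrite big1 ?addr0 // => u ut; rewrite coeffU (negbTE ut) mulr0.
rewrite big1_seq => [|u /= us].
  by apply/esym/eqP; rewrite -[_ == _]negbK -ts.
rewrite coeffU; case: eqVneq us => [->|]; rewrite ?mulr0 //.
by rewrite mem_undup (negbTE fs).
Qed.

(** * Injective maps out of a quotient group *)

Section QuotientLift.
Variables (H G G' : groupType) (f : UMagmaMorphism.type H G).
Hypothesis mulGC : forall x y : G, (x * y = y * x)%g.
Variable g : G -> G'.
Hypothesis gP : forall x y, g x = g y <-> quot_rel f x y.
Hypothesis gM : {morph g : x y / (x * y)%g}.

(** One direction of [gP] makes the value independent of the representative, the other gives
    injectivity. *)
Definition quotient_lift (x : quotient_group f mulGC) : G' := g (repr x).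

Lemma quotient_lift_pi x : quotient_lift (\pi x) = g x.
Proof. by apply/gP/eqmodP; rewrite reprK. Qed.

Lemma quotient_lift_inj : injective quotient_lift.
Proof.
by move=> x y /gP xy; rewrite -[x]reprK -[y]reprK; apply/eqmodP.
Qed.

Lemma quotient_liftM : {morph quotient_lift : x y / (x * y)%g}.
Proof.
move=> x y; rewrite -[x]reprK -[y]reprK.
by rewrite -[X in quotient_lift X]pi_quot_mul !quotient_lift_pi gM.
Qed.

End QuotientLift.

(** * Principal ideals and the embedding of the quotient of unit groups *)

Section PrincipalIdeals.
Variable D : idomainType.
Local Notation K := {fraction D}.
Local Notation A := (integral_closure D).

(** Each generator is a multiple of the other, by [a] and [b] in [D]; cancelling [y] gives
    [b * a = 1]. *)
Lemma principal_ideal_eqP (x y : K) : x != 0 -> y != 0 ->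
  principal_ideal x = principal_ideal y <->
  exists h : unit_group D, x = tofrac (unit_val h) * y.
Proof.
move=> x0 y0; split=> [xy|[h ->]].
  have [a aE] : principal_ideal x y.
    by rewrite xy; exists 1; rewrite tofrac1 mulr1.
  have [b bE] : principal_ideal y x.
    by rewrite -xy; exists 1; rewrite tofrac1 mulr1.
  have ba : b * a = 1.
    apply/eqP; rewrite -tofrac_eq tofracM tofrac1; apply/eqP/(mulfI y0).
    by rewrite mulrA -bE -aE mulr1.
  have bU : b \is a GRing.unit by apply/unitrPr; exists a.
  by exists (UnitGroup bU); rewrite bE mulrC.
apply/seteqP; split=> z [d ->].
  by exists (unit_val h * d); rewrite tofracM mulrCA mulrA.
exists ((unit_val h)^-1 * d).
by rewrite mulrAC -tofracM mulVKr ?unit_valP // mulrC.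
Qed.

Definition princ_of (x : K) (x0 : x != 0) : Princ D :=
  MkPrinc (introT (asboolP _) (ex_intro2 _ _ x x0 erefl)).

Lemma icl_val_unit_neq0 (u : unit_group A) : icl_val (unit_val u) != 0.
Proof. by have /andP[] : icl_unit (unit_val u) := unit_valP u. Qed.

Definition unit_princ (u : unit_group A) : Princ D :=
  princ_of (icl_val_unit_neq0 u).

Lemma unit_princM : {morph unit_princ : u v / (u * v)%g}.
Proof. by move=> u v; apply: val_inj; rewrite /= principal_ideal_mul. Qed.

Lemma unit_valM (R : unitRingType) (u v : unit_group R) :
  unit_val (u * v)%g = unit_val u * unit_val v.
Proof. by []. Qed.

Lemma icl_valM (x y : A) : icl_val (x * y) = icl_val x * icl_val y.
Proof. exact: (rmorphM (val : A -> K)). Qed.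

Lemma icl_val_unit_map (h : unit_group D) (u : unit_group A) :
  icl_val (unit_val (unit_map (@to_icl D) h * u)%g) =
  tofrac (unit_val h) * icl_val (unit_val u).
Proof. by rewrite unit_valM icl_valM. Qed.

Lemma unit_group_val_inj (u v : unit_group A) :
  icl_val (unit_val u) = icl_val (unit_val v) -> u = v.
Proof. by move=> /(@val_inj _ _ A)/(@val_inj _ _ (unit_group A)). Qed.

(** This is the condition [gP] under which [unit_princ] descends to an embedding of the quotient of
    unit groups into [Princ D]. *)
Lemma unit_princ_eqP (u v : unit_group A) :
  unit_princ u = unit_princ v <-> quot_rel (unit_map (@to_icl D)) u v.
Proof.
rewrite -(rwP (quot_relP _ _ _)); split=> [/(congr1 val)|[h ->]].
  move=> /principal_ideal_eqP[||h e]; try exact: icl_val_unit_neq0.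
  by exists h; apply: unit_group_val_inj; rewrite icl_val_unit_map.
apply/val_inj/principal_ideal_eqP; try exact: icl_val_unit_neq0.
by exists h; rewrite icl_val_unit_map.
Qed.

End PrincipalIdeals.

(** * Values of products and inverses *)

Section DiscreteValuation.
Variables (F : fieldType) (v : F -> int).
Hypothesis dv : discrete_valuation v.

Lemma discrete_valuationM x y : x != 0 -> y != 0 -> v (x * y) = v x + v y.
Proof. by case: dv => vM _ _; apply: vM. Qed.

Lemma discrete_valuationV x : x != 0 -> v x^-1 = - v x.
Proof.
move=> x0; have v1 : v 1 = 0.
  apply: (addIr (v 1)); rewrite add0r.
  by rewrite -discrete_valuationM ?oner_neq0 ?mulr1.
apply: (addIr (v x)); rewrite addNr -v1.
by rewrite -discrete_valuationM ?invr_eq0 // mulVf.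
Qed.

End DiscreteValuation.

(** * The divisor homomorphism and its kernel *)

Section Divisor.
Variable D : idomainType.
Local Notation K := {fraction D}.
Local Notation A := (integral_closure D).
Local Notation L := {fraction A}.
Variable V : set (L -> int).
Hypothesis Vdv : forall v, V v -> discrete_valuation v.
Hypothesis Vint : forall x : L, x != 0 ->
  ((exists a : A, x = tofrac a) <-> forall v, V v -> 0 <= v x).
Hypothesis Vfin : forall x : L, x != 0 -> finite_set [set v | V v /\ v x != 0].

(* Indexing by all functions, with order 0 outside [V], avoids a subtype. *)
Let T : choiceType := {classic (L -> int)}.
Let ord (v : T) (x : K) : int :=
  if `[< V v >] then (v : L -> int) (frac_icl x) else 0.

Lemma ordM v x y : x != 0 -> y != 0 -> ord v (x * y) = ord v x + ord v y.
Proof.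
move=> x0 y0; rewrite /ord; case: asboolP => // Vv.
by rewrite frac_iclM (discrete_valuationM (Vdv Vv)) ?frac_icl_eq0.
Qed.

(** If all orders vanish, then [Vint] puts both [x] and its inverse in the integral closure;
    conversely a unit and its inverse both have nonnegative values. *)
Lemma ord_eq0P (x : K) : x != 0 ->
  (forall v, ord v x = 0) <-> exists u : unit_group A, x = icl_val (unit_val u).
Proof.
move=> x0; have fx0 : frac_icl x != 0 by rewrite frac_icl_eq0.
split=> [vx0|[u ->] v].
  have {}vx0 v : V v -> v (frac_icl x) = 0.
    by move=> Vv; have := vx0 v; rewrite /ord asboolT.
  have [a aE] : exists a : A, frac_icl x = tofrac a.
    by apply/Vint => // v Vv; rewrite vx0.
  have [b bE] : exists b : A, (frac_icl x)^-1 = tofrac b.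
    apply/Vint; first by rewrite invr_eq0.
    by move=> v Vv; rewrite (discrete_valuationV (Vdv Vv)) ?vx0 ?oppr0.
  have aU : a \is a GRing.unit.
    apply/unitrPr; exists b; apply/eqP; rewrite -tofrac_eq tofracM tofrac1.
    by rewrite -aE -bE mulfV.
  by exists (UnitGroup aU); apply: frac_icl_tofrac.
rewrite /ord; case: asboolP => // Vv; rewrite frac_icl_val.
have uU := unit_valP u; set a := unit_val u in uU *.
have a0 : tofrac a != 0.
  by rewrite tofrac_eq0; apply: contraTneq uU => ->; rewrite unitr0.
have aV : (tofrac a)^-1 = tofrac a^-1.
  by apply: (mulfI a0); rewrite mulfV // -tofracM mulrV // tofrac1.
apply/eqP; rewrite eq_le; apply/andP; split.
  rewrite -oppr_ge0 -(discrete_valuationV (Vdv Vv)) //.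
  by apply: (Vint _).1 Vv; rewrite ?invr_eq0 //; exists a^-1.
by apply: (Vint _).1 Vv; rewrite //; exists a.
Qed.

(** Finite character makes the support finite. Two generators differ by a unit of [D], which is a
    unit of the closure and so has order 0 everywhere. *)
Lemma divisor_exists (P : Princ D) : exists d : {freeg T},
  forall x : K, x != 0 -> princ_val P = principal_ideal x ->
  forall v, coeff v d = ord v x.
Proof.
have [x x0 Px] := princP P.
have fx0 : frac_icl x != 0 by rewrite frac_icl_eq0.
have [|d dE] := @freeg_of_finite_support T (fun v => ord v x).
  apply: sub_finite_set (Vfin fx0) => v /=.
  by rewrite /ord; case: asboolP; rewrite ?eqxx.
exists d => y y0 Py v; rewrite dE.
have /principal_ideal_eqP[//|//|h ->] : principal_ideal x = principal_ideal y.
  by rewrite -Px.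
have h0 : tofrac (unit_val h) != 0 :> K.
  by rewrite tofrac_eq0; apply: contraTneq (unit_valP h) => ->; rewrite unitr0.
rewrite ordM // (ord_eq0P h0).2 ?add0r //.
by exists (unit_map (@to_icl D) h).
Qed.

Lemma princ_free_iff_units_free :
  free_abelian (Princ D) <-> free_abelian (units_quotient D).
Proof.
(* As [qE] holds for every generator, [q] can be computed on the product [x * y] of generators,
   whence its additivity. *)
have [q qE] := choice divisor_exists.
have UC (x y : units_quotient D) : (x * y = y * x)%g by exact: quotient_groupC.
have PC (P Q : Princ D) : (P * Q = Q * P)%g.
  apply: val_inj => /=; have [[x _ ->] [y _ ->]] := (princP P, princP Q).
  by rewrite !principal_ideal_mul mulrC.
pose i : units_quotient D -> Princ D := quotient_lift (@unit_princ D).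
apply: (@free_abelian_extension (units_quotient D) (Princ D) T i q UC PC).
- exact: quotient_liftM (@unit_princ_eqP D) (@unit_princM D).
- move=> P Q; have [[x x0 Px] [y y0 Qy]] := (princP P, princP Q).
  have PQ : princ_val (P * Q)%g = principal_ideal (x * y).
    by rewrite /= Px Qy principal_ideal_mul.
  apply/eqP/freeg_eqP => v.
  rewrite coeffD (qE _ _ x0 Px) (qE _ _ y0 Qy).
  by rewrite (qE _ _ _ PQ) ?mulf_neq0 ?ordM.
- exact: quotient_lift_inj (@unit_princ_eqP D).
move=> P; have [x x0 Px] := princP P; split=> [q0|[n ->]].
  (* An ideal of divisor 0 is generated by a unit of the closure, so it comes from the class of that
     unit. *)
  have [|u xu] := (ord_eq0P x0).1.
    by move=> v; rewrite -(qE _ _ x0 Px) q0 coeff0.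
  exists (\pi u); rewrite /i (quotient_lift_pi _ (@unit_princ_eqP D)).
  by apply: val_inj; rewrite /= Px xu.
apply/eqP/freeg_eqP => v; rewrite coeff0 -[n]reprK.
rewrite /i (quotient_lift_pi _ (@unit_princ_eqP D)).
move: (repr n) => u; have u0 := icl_val_unit_neq0 u.
rewrite (qE (unit_princ u) _ u0 erefl); apply: ((ord_eq0P u0).2 _ v).
by exists u.
Qed.

End Divisor.

Theorem proposition4p2 (D : idomainType) :
  ~ GRing.field_axiom D ->
  krull_domain (integral_closure D) ->
  free_abelian (Princ D) <-> free_abelian (units_quotient D).
Proof.
move=> _ [V [Vdv Vint Vfin]].
exact: princ_free_iff_units_free Vdv Vint Vfin.
Qed.
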